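(* For all $m\ge 6$, \[ \gamma^{\mathrm{SID}}(K_m\times P_n)=\begin{cases}3m,& n=5,\\ 3m+6,& n=6.\end{cases} \]
   Context: For a vertex $v$, $N[v]$ is its closed neighborhood. A nonempty set $S\subseteq V(G)$ is a self-identifying code of $G$ if for every vertex $v\in V(G)$: (1) $N[v]\cap S\neq\emptyset$, and (2) $\bigcap_{c\in N[v]\cap S}N[c]=\{v\}$; $\gamma^{\mathrm{SID}}(G)$ is the minimum size of such a code. With $V(K_m)=\{v_0,\dots,v_{m-1}\}$ and $V(P_n)=\{0,\dots,n-1\}$ (consecutively numbered path), the direct product $K_m\times P_n$ has vertices $(v_i,j)$, with $(v_i,j)$ adjacent to $(v_{i'},j')$ iff $i\neq i'$ and $|j-j'|=1$. *)

(* Defs.v *)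
From mathcomp Require Import all_boot.
Set Implicit Arguments.
Unset Strict Implicit.
Unset Printing Implicit Defensive.

Record sgraph := SGraph {
  vertex :> finType;
  adj : rel vertex;
  adj_sym : symmetric adj;
  adj_irrefl : irreflexive adj }.

Section SelfIdentifyingCodes.
Variable G : sgraph.

Definition closed_neigh (v : G) : {set G} := [set u | (u == v) || adj v u].

(* The intersection over an empty index set would be [set: G]; the first
   conjunct on v excludes that case. *)
Definition self_identifying_code (S : {set G}) : Prop :=
  S != set0 /\
  forall v : G,
    closed_neigh v :&: S != set0 /\
    \bigcap_(c in closed_neigh v :&: S) closed_neigh c = [set v].

(* gammaSID_eq k: the minimum size of a self-identifying code exists and is k.
   A relation is used because a graph may have no self-identifying code. *)
Definition gammaSID_eq (k : nat) : Prop :=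
  (exists S : {set G}, self_identifying_code S /\ #|S| = k) /\
  (forall S : {set G}, self_identifying_code S -> k <= #|S|).

End SelfIdentifyingCodes.

Definition complete_adj (m : nat) : rel 'I_m := fun i i' => i != i'.

Lemma complete_adj_sym m : symmetric (@complete_adj m).
Proof. by move=> i j; rewrite /complete_adj eq_sym. Qed.

Lemma complete_adj_irrefl m : irreflexive (@complete_adj m).
Proof. by move=> i; rewrite /complete_adj eqxx. Qed.

Definition complete_graph (m : nat) : sgraph :=
  SGraph (@complete_adj_sym m) (@complete_adj_irrefl m).

Definition path_adj (n : nat) : rel 'I_n :=
  fun j j' => (j.+1 == j' :> nat) || (j'.+1 == j :> nat).

Lemma path_adj_sym n : symmetric (@path_adj n).
Proof. by move=> i j; rewrite /path_adj orbC. Qed.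

Lemma path_adj_irrefl n : irreflexive (@path_adj n).
Proof. by move=> i; rewrite /path_adj orbb gtn_eqF. Qed.

Definition path_graph (n : nat) : sgraph :=
  SGraph (@path_adj_sym n) (@path_adj_irrefl n).

Section DirectProduct.
Variables G H : sgraph.

Definition direct_adj : rel (G * H)%type :=
  fun x y => adj x.1 y.1 && adj x.2 y.2.

Lemma direct_adj_sym : symmetric direct_adj.
Proof. by move=> x y; rewrite /direct_adj adj_sym [adj x.2 _]adj_sym. Qed.

Lemma direct_adj_irrefl : irreflexive direct_adj.
Proof. by move=> x; rewrite /direct_adj adj_irrefl. Qed.

Definition direct_product : sgraph := SGraph direct_adj_sym direct_adj_irrefl.

End DirectProduct.

(* Main.v *)
Require Import Defs.
From mathcomp Require Import all_boot.
From mathcomp Require Import zify.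
Set Implicit Arguments.
Unset Strict Implicit.
Unset Printing Implicit Defensive.

(** Write [a_j] for the number of codewords in the [j]-th layer [K_m x {j}].
    A self-identifying code is a set [S] such that for all [u != v] some
    codeword lies in [N[v]] but not in [N[u]].  Separating an end layer from the
    layer at distance two forces the end layer to be full, and separating it
    from the adjacent layer forces three codewords there.  Separating vertices
    of one layer [j] forces [a_(j-1) + a_(j+1) >= m], unless layer [j] misses at
    most one vertex.  These inequalities imply both lower bounds.  They are
    attained by the layer sizes [m, 3, 0, m - 3, m], with layers 1 and 3
    complementary, and by [m, 3, m, 0, 3, m]. *)

(** * Self-identifying codes as separating sets *)

Section Separation.
Variable G : sgraph.
Implicit Types (S : {set G}) (u v c : G).

Definition separating S : Prop := forall v u, u != v ->
  exists c, [/\ c \in S, c \in closed_neigh v & c \notin closed_neigh u].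

Lemma closed_neigh_sym u v : (u \in closed_neigh v) = (v \in closed_neigh u).
Proof. by rewrite !inE eq_sym adj_sym. Qed.

(** Since [u] is not in the intersection at [v], some [N[c]] misses [u]; by symmetry [c] is outside
    [N[u]]. *)
Lemma self_identifying_code_separating S :
  self_identifying_code S -> separating S.
Proof.
move=> [_ codeS] v u neq_uv; have [_ capS] := codeS v.
have: u \notin \bigcap_(c in closed_neigh v :&: S) closed_neigh c.
  by rewrite capS inE.
case: (pickP [pred c | (c \in closed_neigh v :&: S)
                        && (u \notin closed_neigh c)]) => /=.
  move=> c /andP[/setIP[cv cS]]; rewrite closed_neigh_sym => cu _.
  by exists c.
move=> none /bigcapP[] c cvS.
by move/negbT: (none c); rewrite /= cvS negbK.
Qed.

(** A codeword separating [v] from any other vertex lies in [N[v]], which gives domination; on a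
    single vertex separation would be vacuous. *)
Lemma separating_self_identifying_code S :
  1 < #|G| -> separating S -> self_identifying_code S.
Proof.
move=> /card_gt1P[x [y [_ _ neq_xy]]] sepS.
have neigh_neq0 v : closed_neigh v :&: S != set0.
  have [u neq_uv] : exists u, u != v.
    by case: (eqVneq x v) => [<-|?]; [exists y; rewrite eq_sym | exists x].
  have [c [cS cv _]] := sepS v u neq_uv.
  by apply/set0Pn; exists c; rewrite inE cv.
split=> [|v].
  by have /set0Pn[c /setIP[_ cS]] := neigh_neq0 x; apply/set0Pn; exists c.
split=> //; apply/setP=> u; rewrite inE; apply/bigcapP/eqP => [uP|-> c].
  apply/eqP/negPn/negP => /(sepS v)[c [cS cv]].
  by rewrite closed_neigh_sym uP // inE cv.
by rewrite inE closed_neigh_sym => /andP[].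
Qed.

End Separation.

(** * Sets with more than two elements *)

Lemma card_gt2_avoid (T : finType) (A : {set T}) : 1 < #|T| ->
    (forall x y, x != y -> exists z, [/\ z \in A, z != x & z != y]) ->
  2 < #|A|.
Proof.
move=> /card_gt1P[x [y [_ _ neq_xy]]] avoidA.
have [a [aA _ _]] := avoidA x y neq_xy.
have [b neq_ab] : exists b, a != b.
  by case: (eqVneq a x) => [->|?]; [exists y | exists x].
have [c [cA neq_ca _]] := avoidA a b neq_ab.
have [e [eA neq_ea neq_ec]] := avoidA c a neq_ca.
apply/card_gt2P; exists a, c, e; split=> //.
by split; rewrite // eq_sym.
Qed.

Lemma card_gt2_pick (T : finType) (A : {set T}) x y : 2 < #|A| ->
  exists z, [/\ z \in A, z != x & z != y].
Proof.
move=> A_gt2; have: 0 < #|A :\: [set x; y]|.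
  have := cardsID [set x; y] A.
  have := subset_leq_card (subsetIr A [set x; y]).
  have := cards2 x y; case: (x != y) => /=; lia.
by case/card_gt0P=> z; rewrite !inE negb_or => /andP[/andP[]]; exists z.
Qed.

(** * Layers of a code in the product of [K_m] with a graph *)

Section Layers.
Variables (m : nat) (H : sgraph).
Let G := direct_product (complete_graph m) H.
Implicit Types (S : {set G}) (j k l : H) (i : 'I_m).

Definition layer S j : {set 'I_m} := [set i | (i, j) \in S].

Lemma card_layers S : #|S| = \sum_j #|layer S j|.
Proof.
rewrite -sum1_card big_mkcond /=.
transitivity (\sum_(i : 'I_m) \sum_(j : H) (((i, j) : G) \in S : nat)).
  by rewrite pair_bigA; apply: eq_bigr => -[i j] _ /=; case: ifP.
rewrite exchange_big /=; apply: eq_bigr => j _.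
rewrite -sum1_card [RHS]big_mkcond /=; apply: eq_bigr => i _.
by rewrite inE; case: ifP.
Qed.

Lemma closed_neigh_directE (i i' : 'I_m) j j' :
  (((i', j') : G) \in closed_neigh ((i, j) : G)) =
  (i' == i) && (j' == j) || (i != i') && adj j j'.
Proof. by rewrite inE. Qed.

(** Every neighbour of [(i, j)] is also one of [(i, l)], so only [(i, j)] itself can separate it
    from [(i, l)]. *)
Lemma layer_full S j l : separating S -> l != j -> ~~ adj j l ->
  (forall k, adj j k -> adj l k) -> layer S j = setT.
Proof.
move=> sepS neq_lj nadj_jl sub_jl; apply/setP=> i; rewrite !inE.
have neq_uv : ((i, l) : G) != (i, j) by rewrite xpair_eqE eqxx.
have [[k k'] [cS]] := sepS _ _ neq_uv.
rewrite !closed_neigh_directE => /orP[/andP[/eqP<- /eqP<-] //|].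
by case/andP=> neq_ik /sub_jl ->; rewrite neq_ik orbT.
Qed.

(** For [x != y], a codeword separating [(x, j)] from [(y, l)] cannot be [(x, j)], which is adjacent
    to [(y, l)]. So it lies in layer [l], with first coordinate outside [{x, y}]. *)
Lemma layer_gt2 S j l : 1 < m -> separating S -> adj j l ->
  (forall k, adj j k -> k = l) -> 2 < #|layer S l|.
Proof.
move=> m_gt1 sepS adj_jl only_l.
apply: card_gt2_avoid => [|x y neq_xy]; first by rewrite card_ord.
have neq_uv : ((y, l) : G) != (x, j).
  by rewrite xpair_eqE eq_sym (negPf neq_xy).
have [[k k'] [cS]] := sepS _ _ neq_uv.
rewrite !closed_neigh_directE => /orP[/andP[/eqP-> /eqP->]|].
  by rewrite (eq_sym y) neq_xy adj_sym adj_jl orbT.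
case/andP=> neq_xk /only_l Dk'; move: cS; rewrite Dk' eqxx andbT negb_or.
by move=> kS /andP[neq_ky _]; exists k; rewrite inE kS eq_sym neq_xk.
Qed.

(** Among the neighbours of [(i, j)], only those with first coordinate [i'] are not adjacent to
    [(i', j)]. *)
Lemma layer_cover S j i i' : separating S -> i != i' -> i \notin layer S j ->
  exists2 k, adj j k & i' \in layer S k.
Proof.
move=> sepS neq_ii'; rewrite inE => iNS.
have neq_uv : ((i', j) : G) != (i, j) by rewrite xpair_eqE eq_sym (negPf neq_ii').
have [[x k] [cS]] := sepS _ _ neq_uv.
rewrite !closed_neigh_directE => /orP[/andP[/eqP Dx /eqP Dk]|].
  by rewrite Dx Dk (negPf iNS) in cS.
case/andP=> _ adj_jk; rewrite adj_jk andbT negb_or negbK => /andP[_ /eqP Dx].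
by exists k => //; rewrite inE Dx.
Qed.

(** The cases are that layer [j] misses no index, at least two, or exactly one. A missing [x] makes
    the neighbouring layers cover all indices but [x], and two missing indices make them cover
    everything. *)
Lemma card_layer_cover S j k1 k2 : separating S ->
    (forall k, adj j k -> k = k1 \/ k = k2) ->
  [\/ m <= #|layer S j|,
      m <= #|layer S k1| + #|layer S k2| |
      m.-1 <= #|layer S j| /\ m.-1 <= #|layer S k1| + #|layer S k2|].
Proof.
move=> sepS adj_j; set U := layer S k1 :|: layer S k2.
have cardU : #|U| <= #|layer S k1| + #|layer S k2| by rewrite cardsU leq_subr.
have coverU x : x \notin layer S j -> [set~ x] \subset U.
  move=> xN; apply/subsetP=> y; rewrite !inE eq_sym => neq_xy.
  have [k /adj_j[]-> ] := layer_cover sepS neq_xy xN;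
    by rewrite inE => ->; rewrite ?orbT.
have cardC (x : 'I_m) : #|[set~ x]| = m.-1 by rewrite cardsC1 card_ord.
have := cardsC (layer S j); rewrite card_ord => card_j.
have [le1|/card_gt1P[x [y [xN yN neq_xy]]]] := leqP #|~: layer S j| 1.
  have [/eqP|/card_gt0P[x]] := posnP #|~: layer S j|.
    by move/eqP => c0; apply: Or31; lia.
  rewrite inE => /coverU/subset_leq_card; rewrite cardC => le_m.
  by apply: Or33; lia.
apply: Or32; apply: leq_trans cardU; rewrite -{1}(card_ord m) -cardsT.
apply/subset_leq_card/subsetP=> z _; rewrite !inE in xN yN.
have [->|neq_zx] := eqVneq z x.
  by apply: (subsetP (coverU y _)); rewrite !inE.
by apply: (subsetP (coverU x _)); rewrite !inE.
Qed.

(* The codeword separating [(i, j)] from [(i', j')] is [(i, j)] itself or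
   [(k, l)] with [k] outside [{i, i'}]. *)
Lemma layers_separating S :
    (forall j i i', i != i' ->
       i \in layer S j \/ exists2 k, adj j k & i' \in layer S k) ->
    (forall j j', j' != j ->
       (layer S j = setT /\ ~~ adj j' j) \/
       exists l, [/\ adj j l, ~~ adj j' l & 2 < #|layer S l|]) ->
  separating S.
Proof.
move=> same_layer diff_layer [i j] [i' j'].
have [->|neq_j'j] := eqVneq j' j.
  rewrite xpair_eqE eqxx andbT eq_sym => neq_ii'.
  have [|[k adj_jk]] := same_layer j _ _ neq_ii'; rewrite inE => cS.
    exists (i, j); rewrite cS !closed_neigh_directE !eqxx; split=> //.
    by rewrite (negPf neq_ii') adj_irrefl andbF.
  (* Within one layer, [(i', k)] is adjacent to [(i, j)] but not to [(i', j)]. *)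
  exists (i', k); rewrite cS !closed_neigh_directE !eqxx neq_ii' adj_jk orbT.
  split=> //; rewrite orbF /=; apply/negP=> /eqP Dk.
  by rewrite Dk adj_irrefl in adj_jk.
move=> _; have [[fullj nadj]|[l [adj_jl nadj gt2]]] := diff_layer j j' neq_j'j.
  have : i \in layer S j by rewrite fullj inE.
  rewrite inE => cS; exists (i, j); rewrite cS !closed_neigh_directE !eqxx.
  by split=> //; rewrite (negPf nadj) (eq_sym j) (negPf neq_j'j) !andbF.
have [k [kl neq_ki neq_ki']] := card_gt2_pick i i' gt2.
exists (k, l); rewrite inE in kl; rewrite kl !closed_neigh_directE.
by rewrite (negPf neq_ki) (negPf neq_ki') (negPf nadj) adj_jl (eq_sym i) neq_ki andbF.
Qed.

End Layers.

(** * Building codes over a path from their layers *)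

Section PathLayers.
Variables (m n : nat).
Let G := direct_product (complete_graph m) (path_graph n).

Definition layered (L : nat -> {set 'I_m}) : {set G} :=
  [set x : G | x.1 \in L (val x.2)].

Lemma layer_layered L (j : path_graph n) : layer (layered L) j = L (val j).
Proof. by apply/setP=> i; rewrite !inE. Qed.

Lemma card_layered L : #|layered L| = \sum_(0 <= j < n) #|L j|.
Proof.
rewrite card_layers big_mkord; apply: eq_bigr => j _.
by rewrite layer_layered.
Qed.

(** Stated on bare numbers so that it evaluates on numerals. *)
Definition nat_adj (j k : nat) := (j.+1 == k) || (k.+1 == j).

(* [full] and [big] record which layers are all of [K_m] and which have more
   than two elements, so that the last hypothesis is decided by computation. *)
Lemma layered_code (L : nat -> {set 'I_m}) (full big : seq nat) :
    1 < m -> 0 < n ->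
    (forall j, j \in full -> L j = setT) ->
    (forall j, j \in big -> 2 < #|L j|) ->
    (forall j i, j < n -> j \notin full ->
       exists k, [/\ k < n, nat_adj j k & i \in L k]) ->
    all (fun j => all (fun j' => [|| j == j',
            (j \in full) && ~~ nat_adj j' j |
            has (fun l => [&& nat_adj j l, ~~ nat_adj j' l & l \in big])
              (iota 0 n)]) (iota 0 n)) (iota 0 n) ->
  self_identifying_code (layered L).
Proof.
move=> m_gt1 n_gt0 fullL bigL coverL diffL.
apply: separating_self_identifying_code.
  by rewrite card_prod !card_ord; nia.
apply: layers_separating => [j i i' neq_ii'|j j' neq_j'j].
  rewrite layer_layered; have [/fullL->|/coverL] := boolP (val j \in full).
    by left; rewrite inE.
  move=> /(_ i' (ltn_ord j))[k [lt_kn adj_jk ik]]; right.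
  by exists (Ordinal lt_kn) => //; rewrite layer_layered.
rewrite layer_layered.
have iotaP (k : 'I_n) : val k \in iota 0 n by rewrite mem_iota ltn_ord.
have /allP/(_ _ (iotaP j'))/or3P[|/andP[/fullL-> nadj]|/hasP[l]] :=
  allP diffL _ (iotaP j).
- by rewrite eq_sym => /eqP/val_inj e; rewrite e eqxx in neq_j'j.
- by left.
rewrite mem_iota /= add0n => lt_ln /and3P[adj_jl nadj /bigL gt2].
by right; exists (Ordinal lt_ln); rewrite layer_layered.
Qed.

End PathLayers.

(** * Optimal codes for paths on five and six vertices *)

Lemma card_first_ord m k : k <= m -> #|[set i : 'I_m | i < k]| = k.
Proof.
move=> le_km; have inj_w : injective (widen_ord le_km).
  by move=> x y /(congr1 val) e; apply: val_inj.
rewrite -[RHS]card_ord -(card_imset _ inj_w).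
apply: eq_card => i; rewrite inE; apply/idP/imsetP => [lt_ik|[x _ ->]].
  by exists (Ordinal lt_ik) => //; apply: val_inj.
by rewrite /= ltn_ord.
Qed.

Lemma card_first_ordC m k : k <= m -> #|~: [set i : 'I_m | i < k]| = m - k.
Proof. by move=> le_km; rewrite cardsCs setCK card_ord card_first_ord. Qed.

Definition code5 m := layered 5 (fun j =>
  nth set0 [:: setT; [set i : 'I_m | i < 3]; set0; ~: [set i : 'I_m | i < 3];
               setT] j).

Definition code6 m := layered 6 (fun j =>
  nth set0 [:: setT; [set i : 'I_m | i < 3]; setT; set0;
               [set i : 'I_m | i < 3]; setT] j).

Lemma code5P m : 6 <= m -> self_identifying_code (code5 m).
Proof.
move=> m_ge6.
apply: (@layered_code _ _ _ [:: 0; 4] [:: 0; 1; 3; 4]) => //.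
- by lia.
- by move=> j; rewrite !inE => /orP[]/eqP->.
(* Layer 3 has [m - 3] elements, which exceeds two because [6 <= m]. *)
- move=> j; rewrite !inE => /or4P[]/eqP-> /=;
    rewrite ?cardsT ?card_first_ordC ?card_first_ord ?card_ord; lia.
- case=> [|[|[|[|[|//]]]]] // i _ _; first by exists 0; rewrite inE.
    (* Layer 2 is covered by the complementary layers 1 and 3. *)
    have [lt_i3|le_3i] := ltnP i 3; [exists 1 | exists 3];
      by rewrite !inE // -leqNgt.
  by exists 4; rewrite inE.
Qed.

Lemma code6P m : 6 <= m -> self_identifying_code (code6 m).
Proof.
move=> m_ge6.
apply: (@layered_code _ _ _ [:: 0; 2; 5] [:: 0; 1; 2; 4; 5]) => //.
- by lia.
- by move=> j; rewrite !inE => /or3P[]/eqP->.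
- move=> j; rewrite !inE => /or4P[||| /orP[]] /eqP-> /=;
    rewrite ?cardsT ?card_first_ordC ?card_first_ord ?card_ord; lia.
(* The layers that are not full are 1, 3 and 4; they are next to the full layers 0, 2 and 5. *)
- case=> [|[|[|[|[|[|//]]]]]] // i _ _.
  + by exists 0; rewrite inE.
  + by exists 2; rewrite inE.
  by exists 5; rewrite inE.
Qed.

Lemma card_code5 m : 6 <= m -> #|code5 m| = 3 * m.
Proof.
move=> m_ge6; rewrite card_layered unlock /= cards0 cardsT card_ord.
by rewrite card_first_ordC ?card_first_ord; lia.
Qed.

Lemma card_code6 m : 6 <= m -> #|code6 m| = 3 * m + 6.
Proof.
move=> m_ge6; rewrite card_layered unlock /= cards0 cardsT card_ord.
by rewrite card_first_ord; lia.
Qed.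

(** * Lower bounds on layer sizes over a path *)

Section PathLowerBound.
Variables (m n : nat) (S : {set direct_product (complete_graph m) (path_graph n)}).
Hypothesis codeS : self_identifying_code S.
Let sepS := self_identifying_code_separating codeS.

(* Equal to [0] for [j >= n]. *)
Definition layer_size (j : nat) : nat :=
  if insub j is Some j' then #|layer S (j' : path_graph n)| else 0.

Lemma layer_sizeE (j : path_graph n) : layer_size (val j) = #|layer S j|.
Proof. by rewrite /layer_size valK. Qed.

Lemma card_layer_size : #|S| = \sum_(0 <= j < n) layer_size j.
Proof.
by rewrite card_layers big_mkord; apply: eq_bigr => j _; rewrite layer_sizeE.
Qed.

Lemma layer_size_end j l : j < n -> l < n ->
    (forall k, nat_adj j k -> k < n -> nat_adj l k) -> l != j -> ~~ nat_adj j l ->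
  layer_size j = m.
Proof.
move=> lt_jn lt_ln sub_jl neq_lj nadj_jl.
rewrite -[j]/(val (Ordinal lt_jn)) layer_sizeE.
rewrite (@layer_full _ (path_graph n) _ _ (Ordinal lt_ln) sepS) ?cardsT ?card_ord //.
by move=> k /sub_jl; apply.
Qed.

Lemma layer_size_first : 2 < n -> layer_size 0 = m.
Proof. by move=> n_gt2; apply: (@layer_size_end 0 2); rewrite /nat_adj; lia. Qed.

Lemma layer_size_last : 2 < n -> layer_size n.-1 = m.
Proof.
by move=> n_gt2; apply: (@layer_size_end n.-1 (n - 3)); rewrite /nat_adj; lia.
Qed.

Lemma layer_size_gt2 j l : 1 < m -> j < n -> l < n -> nat_adj j l ->
  (forall k, nat_adj j k -> k < n -> k = l) -> 2 < layer_size l.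
Proof.
move=> m_gt1 lt_jn lt_ln adj_jl only_l.
rewrite -[l]/(val (Ordinal lt_ln)) layer_sizeE.
apply: (@layer_gt2 _ (path_graph n) _ (Ordinal lt_jn)) => // k /only_l e.
by apply: val_inj; apply: e.
Qed.

Lemma layer_size_second : 1 < m -> 1 < n -> 2 < layer_size 1.
Proof. by move=> m_gt1 n_gt1; apply: (@layer_size_gt2 0); rewrite /nat_adj; lia. Qed.

Lemma layer_size_penultimate : 1 < m -> 1 < n -> 2 < layer_size n.-2.
Proof.
by move=> m_gt1 n_gt1; apply: (@layer_size_gt2 n.-1); rewrite /nat_adj; lia.
Qed.

Lemma layer_size_cover j : j.+2 < n ->
  [\/ m <= layer_size j.+1,
      m <= layer_size j + layer_size j.+2 |
      m.-1 <= layer_size j.+1 /\ m.-1 <= layer_size j + layer_size j.+2].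
Proof.
move=> lt2n; have lt1n := ltnW lt2n; have lt0n := ltnW lt1n.
have := @card_layer_cover m (path_graph n) S (Ordinal lt1n) (Ordinal lt0n)
  (Ordinal lt2n) sepS.
rewrite -!layer_sizeE; apply=> k /orP[]/eqP /= e; [right | left];
  by apply: val_inj => /=; lia.
Qed.

End PathLowerBound.

Theorem theoremA4 (m : nat) (hm : 6 <= m) :
  gammaSID_eq (direct_product (complete_graph m) (path_graph 5)) (3 * m) /\
  gammaSID_eq (direct_product (complete_graph m) (path_graph 6)) (3 * m + 6).
Proof.
have m_gt1 : 1 < m by lia.
split; split.
- by exists (code5 m); split; [apply: code5P | apply: card_code5].
- move=> S codeS; rewrite card_layer_size unlock /=.
  have := layer_size_first codeS isT; have := layer_size_last codeS isT.
  have := layer_size_second codeS m_gt1 isT.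
  have := layer_size_penultimate codeS m_gt1 isT.
  (* In each case for layer 2, the three inner layers total at least [m]; the end layers add
     [2 * m]. *)
  by have [] := layer_size_cover codeS (j := 1) isT => /=; lia.
- by exists (code6 m); split; [apply: code6P | apply: card_code6].
move=> S codeS; rewrite card_layer_size unlock /=.
have := layer_size_first codeS isT; have := layer_size_last codeS isT.
have := layer_size_second codeS m_gt1 isT.
have := layer_size_penultimate codeS m_gt1 isT.
(* If layer 2 or 3 has [m] elements, layers 1 and 4 add six. Otherwise the four inner layers total
   at least [2 * m], and [m + 6 <= 2 * m]. *)
have [] := layer_size_cover codeS (j := 1) isT;
  by have [] := layer_size_cover codeS (j := 2) isT => /=; lia.
Qed.
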